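(* Let $\mathcal{A}$ be a linearly ordered structure whose order is an $\eta_0$-set, and let $\lambda$ be an ordinal such that $\aleph_\lambda$ is strongly inaccessible. Consider the ultrapower hierarchy of $\mathcal{A}$ up to $\lambda$ in which, for each $\beta<\lambda$, $\Upsilon_{\beta+1}(\mathcal{A})=\Upsilon_\beta(\mathcal{A})^{\Upsilon_\beta(\mathcal{A})}/\mathcal{U}_\beta$ with $\mathcal{U}_\beta$ a tails ultrafilter over the ordered set $\Upsilon_\beta(\mathcal{A})$. Then $\Upsilon_\lambda(\mathcal{A})$ is an $\eta_\lambda$-set.
   Context: Ultrapower hierarchy: $\Upsilon_0(\mathcal{A})=\mathcal{A}$, successor stages as in the claim (index set equal to the domain of the previous stage), and for limit $\delta$, $\Upsilon_\delta(\mathcal{A})$ is the direct limit of $\Upsilon_\alpha(\mathcal{A})$, $\alpha<\delta$, along the maps $e^\alpha_\alpha=\mathrm{id}$, $e^\alpha_{\gamma+1}(x)=[\text{constant function with value }e^\alpha_\gamma(x)]_{\mathcal{U}_\gamma}$, and canonical maps into the direct limit at limits; orders are the ultrapower/direct-limit orders. A tails ultrafilter over an ordered set $(X,\le)$ contains $\{j\in X\mid k\le j\}$ for every $k\in X$. For an ordinal $\beta$, an ordered set $X$ is an $\eta_\beta$-set if for all $L,R\subseteq X$ with $|L|,|R|<\aleph_\beta$ and $L<R$ (every element of $L$ below every element of $R$) there is $a\in X$ with $L<a<R$. *)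

(* Defs.v *)
From HB Require Import structures.
From mathcomp Require Import all_boot all_order.
From mathcomp Require Import all_classical wochoice.

Set Implicit Arguments.
Unset Strict Implicit.
Unset Printing Implicit Defensive.

Import Order.TTheory.
Local Open Scope classical_set_scope.
Local Open Scope order_scope.
Local Open Scope card_scope.

(* Ordinals are handled as the elements of a well-ordered type [Ord]; the
   element [a] stands for the order type of [[set b | b < a]].  As [Ord] is
   arbitrary, every ordinal occurs this way. *)

Record wellOrderType (d : Order.disp_t) := WellOrder {
  wo_sort :> orderType d;
  wo_wf : well_founded (fun a b : wo_sort => a < b)
}.

Definition ord_zero (d : Order.disp_t) (Ord : wellOrderType d) (a : Ord) : Prop :=
  forall b : Ord, a <= b.

Definition ord_succ (d : Order.disp_t) (Ord : wellOrderType d) (b a : Ord) : Prop :=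
  b < a /\ forall c : Ord, b < c -> a <= c.

Definition ord_limit (d : Order.disp_t) (Ord : wellOrderType d) (a : Ord) : Prop :=
  ~ ord_zero a /\ forall b : Ord, ~ ord_succ b a.

(* A cardinal is represented by any type (or set) of that cardinality. *)

Definition card_lt (T U : Type) (A : set T) (B : set U) : Prop :=
  A #<= B /\ ~ (B #<= A).

(* [p.1] is the order, [p.2] the subset of [X] that it well-orders. *)
Definition wo_subset (X : Type) (p : rel X * pred X) : Prop :=
  wo_chain p.1 p.2.

Definition wo_isomorphic (X : Type) (p q : rel X * pred X) : Prop :=
  exists f : X -> X, set_bij [set x | p.2 x] [set x | q.2 x] f /\
    forall x y, p.2 x -> p.2 y -> q.1 (f x) (f y) = p.1 x y.

(* The Hartogs construction: the type of all order types of well-ordered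
   subsets of [X], each given as an isomorphism class.  For infinite [X] its
   cardinality is the successor cardinal of the cardinality of [X]. *)
Definition hartogs (X : Type) : Type :=
  {C : set (rel X * pred X) | exists p, wo_subset p /\
     C = [set q | wo_subset q /\ wo_isomorphic p q]}.

(* aleph_a is the supremum of aleph_0 and of the successors of the aleph_b,
   b < a.  The disjoint sum below has this cardinality, because
   |a| <= aleph_a. *)
Definition aleph (d : Order.disp_t) (Ord : wellOrderType d) : Ord -> Type :=
  Fix (@wo_wf d Ord) (fun _ => Type)
    (fun a aleph_below =>
       (nat + {b : Ord & {lt_ba : b < a & hartogs (aleph_below b lt_ba)}})%type).

Definition regular_card (K : Type) : Prop :=
  infinite_set [set: K] /\
  forall (I : set K) (F : K -> set K),
    card_lt I [set: K] -> (forall i, I i -> card_lt (F i) [set: K]) ->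
    card_lt (\bigcup_(i in I) F i) [set: K].

Definition strong_limit_card (K : Type) : Prop :=
  forall S : set K, card_lt S [set: K] ->
    card_lt [set B : set K | B `<=` S] [set: K].

Definition strongly_inaccessible (K : Type) : Prop :=
  [/\ ~ countable [set: K], regular_card K & strong_limit_card K].

Definition set_lt (d : Order.disp_t) (X : orderType d) (L R : set X) : Prop :=
  forall x y, L x -> R y -> x < y.

Definition eta_set (dO : Order.disp_t) (Ord : wellOrderType dO) (b : Ord)
    (d : Order.disp_t) (X : orderType d) : Prop :=
  forall L R : set X,
    card_lt L [set: aleph b] -> card_lt R [set: aleph b] -> set_lt L R ->
    exists a : X, set_lt L [set a] /\ set_lt [set a] R.

Record signature := Signature {
  fun_sym : Type;
  rel_sym : Type;
  fun_arity : fun_sym -> nat;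
  rel_arity : rel_sym -> nat
}.

Record loStructure (S : signature) (d : Order.disp_t) := LoStructure {
  lo_sort :> orderType d;
  fun_interp : forall s : fun_sym S, ('I_(fun_arity s) -> lo_sort) -> lo_sort;
  rel_interp : forall s : rel_sym S, ('I_(rel_arity s) -> lo_sort) -> Prop
}.

Definition tails_ultrafilter (d : Order.disp_t) (X : orderType d)
    (U : set_system X) : Prop :=
  UltraFilter U /\ forall k : X, U [set j | k <= j].

(* [Y], with the class map [f |-> cls f], is the ultrapower [X ^ I / U]:
   [cls] is onto and identifies exactly the functions that agree on a set of
   [U], and the order, functions and relations are those of the ultrapower. *)
Record is_ultrapower (S : signature) (d : Order.disp_t) (I : Type)
    (U : set_system I) (X Y : loStructure S d) (cls : (I -> X) -> Y) : Prop := {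
  ultrapower_onto : forall y, exists f, cls f = y;
  ultrapower_eq : forall f g, cls f = cls g <-> U [set i | f i = g i];
  ultrapower_le : forall f g, cls f <= cls g <-> U [set i | f i <= g i];
  ultrapower_fun : forall (s : fun_sym S) (f : 'I_(fun_arity s) -> I -> X),
    fun_interp (fun k => cls (f k))
    = cls (fun i => fun_interp (fun k => f k i));
  ultrapower_rel : forall (s : rel_sym S) (f : 'I_(rel_arity s) -> I -> X),
    rel_interp (fun k => cls (f k))
    <-> U [set i | rel_interp (fun k => f k i)]
}.

(* [X c], with the maps [e a c] for [a < c], is the direct limit of the
   [X a], [a < c], along the maps [e a b], [a <= b < c]. *)
Record is_direct_limit (dO : Order.disp_t) (Ord : wellOrderType dO)
    (S : signature) (d : Order.disp_t) (X : Ord -> loStructure S d)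
    (e : forall a b, X a -> X b) (c : Ord) : Prop := {
  dirlim_cocone : forall a b (x : X a), a <= b -> b < c ->
    e b c (e a b x) = e a c x;
  dirlim_onto : forall y : X c, exists a, a < c /\ exists x : X a, e a c x = y;
  dirlim_eq : forall a b (x : X a) (y : X b), a < c -> b < c ->
    e a c x = e b c y <->
    exists g, [/\ a <= g, b <= g, g < c & e a g x = e b g y];
  dirlim_le : forall a b (x : X a) (y : X b), a < c -> b < c ->
    e a c x <= e b c y <->
    exists g, [/\ a <= g, b <= g, g < c & e a g x <= e b g y];
  dirlim_fun : forall (s : fun_sym S) a (x : 'I_(fun_arity s) -> X a), a < c ->
    fun_interp (fun k => e a c (x k)) = e a c (fun_interp x);
  dirlim_rel : forall (s : rel_sym S) a (x : 'I_(rel_arity s) -> X a), a < c ->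
    rel_interp (fun k => e a c (x k)) <->
    exists g, [/\ a <= g, g < c & rel_interp (fun k => e a g (x k))]
}.

Unset Implicit Arguments.

(* [stage a], [ultra b], [emb a b] and [hclass b c] are only meaningful for
   [a <= lambda], [b < lambda], [a <= b <= lambda] and
   [c = b + 1 <= lambda] respectively; their other values are junk.  The
   index set of the ultrapower leading from [stage b] to [stage c] is
   [stage b] itself. *)
Record ultrapower_hierarchy (dO : Order.disp_t) (Ord : wellOrderType dO)
    (S : signature) (d : Order.disp_t) (A : loStructure S d)
    (lambda : Ord) := UltrapowerHierarchy {
  stage : Ord -> loStructure S d;
  ultra : forall b, set_system (stage b);
  emb : forall a b, stage a -> stage b;
  hclass : forall b c, (stage b -> stage b) -> stage c;
  stage_zero : forall z, ord_zero z -> stage z = A;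
  ultra_ultrafilter : forall b, b < lambda -> UltraFilter (ultra b);
  emb_id : forall a (x : stage a), a <= lambda -> emb a a x = x;
  stage_succ : forall b c, ord_succ b c -> c <= lambda ->
    is_ultrapower (ultra b) (hclass b c);
  emb_succ : forall a b c (x : stage a), ord_succ b c -> c <= lambda ->
    a <= b -> emb a c x = hclass b c (fun _ : stage b => emb a b x);
  stage_limit : forall c, ord_limit c -> c <= lambda -> is_direct_limit emb c
}.

Set Implicit Arguments.

Arguments ultrapower_hierarchy {dO Ord S d} A lambda.
Arguments UltrapowerHierarchy {dO Ord S d A lambda}.
Arguments stage {dO Ord S d A lambda} _ _.
Arguments ultra {dO Ord S d A lambda} _ _ _.
Arguments emb {dO Ord S d A lambda} _ _ _ _.
Arguments hclass {dO Ord S d A lambda} _ _ _ _.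
Arguments stage_zero {dO Ord S d A lambda} _ {z}.
Arguments ultra_ultrafilter {dO Ord S d A lambda} _ {b}.
Arguments emb_id {dO Ord S d A lambda} _ {a}.
Arguments stage_succ {dO Ord S d A lambda} _ {b c}.
Arguments emb_succ {dO Ord S d A lambda} _ {a b c}.
Arguments stage_limit {dO Ord S d A lambda} _ {c}.

(* Main.v *)
(** As [aleph lambda] is a regular limit cardinal, [lambda] is a limit ordinal
    and every family of fewer than [aleph lambda] ordinals below [lambda] is
    bounded below [lambda].  Hence two sets [L < R] of size less than
    [aleph lambda] in the last stage both come from one stage [a < lambda].  If
    [L] has no maximum, a strictly increasing sequence of elements of [L]
    indexed by the ordinals [a <= b < c], with [c < lambda] a limit, is cofinal
    in [L].  Every stage has elements above the whole previous stage, so the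
    map sending a point of stage [c] to the element of [L] indexed by a stage
    where that point already occurs exceeds each element of [L] on a tail: its
    class in stage [c + 1] lies between [L] and [R].  The same works from the
    side of [R] if [R] has no minimum, and the remaining cases only need that
    the last stage is a dense order without end points. *)

Require Import Defs.
From mathcomp Require Import all_boot all_order.
From mathcomp Require Import all_classical wochoice.

Set Implicit Arguments.
Unset Strict Implicit.
Unset Printing Implicit Defensive.

Import Order.TTheory.
Local Open Scope classical_set_scope.
Local Open Scope order_scope.
Local Open Scope card_scope.

(** * Comparing cardinalities of sets *)

Lemma card_le_intro (T U : Type) (A : set T) (B : set U) (f : T -> U) :
  (forall x, A x -> B (f x)) ->
  (forall x y, A x -> A y -> f x = f y -> x = y) -> A #<= B.
Proof.
move=> fAB finj.
have /Pinj[g gE] : {in A &, injective f}.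
  by move=> x y /set_mem Ax /set_mem Ay; exact: finj.
have /injPfun[h _] : {homo g : x / A x >-> B x} by rewrite -gE.
exact: inj_card_le h.
Qed.

Lemma card_leT_intro (T U : Type) (f : T -> U) :
  injective f -> [set: T] #<= [set: U].
Proof. by move=> fi; apply: (@card_le_intro _ _ _ _ f) => // x y _ _ /fi. Qed.

Lemma card_le_ex (T U : Type) (u0 : U) (A : set T) (B : set U) : A #<= B ->
  exists f : T -> U, (forall x, A x -> B (f x)) /\
    (forall x y, A x -> A y -> f x = f y -> x = y).
Proof.
move=> /card_leP[g].
pose f x := if pselect (A x) is left Ax then \val (g (exist _ x (mem_set Ax))) else u0.
have fE x (Ax : A x) : f x = \val (g (exist _ x (mem_set Ax))).
  by rewrite /f; case: pselect => // Ax'; congr (\val (g _)); apply: val_inj.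
exists f; split=> [x Ax|x y Ax Ay].
  by rewrite fE; apply/set_mem/valP.
rewrite !fE => /val_inj gxy.
by have := 'inj_g (mem_setT _) (mem_setT _) gxy => /(congr1 \val).
Qed.

Lemma card_lt_le (T U V : Type) (A : set T) (B : set U) (C : set V) :
  A #<= B -> card_lt B C -> card_lt A C.
Proof.
move=> AB [BC CB]; split; first exact: card_le_trans AB BC.
by move=> CA; apply: CB; apply: card_le_trans CA AB.
Qed.

Lemma cantor (X : Type) : ~ ([set: set X] #<= [set: X]).
Proof.
move=> XX.
have [x0|nX] := pselect (exists x : X, True); last first.
  have /card_leP[f] := XX.
  by apply: nX; exists (\val (f (exist _ set0 (mem_setT _)))).
have {x0}[x0 _] := x0.
have [f [_ fi]] := card_le_ex x0 XX.
pose D := [set x | forall B, f B = x -> ~ B x].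
have nD : ~ D (f D) by move=> h; exact: (h D erefl h).
by apply: (nD) => B /(fi _ _ I I) ->.
Qed.

(** [strong_limit_card] speaks only of subsets of [K], so [T] is replaced by its copy in [K]; direct
    image along an injection is injective on sets. *)
Lemma card_lt_set (K T : Type) : strong_limit_card K ->
  card_lt [set: T] [set: K] -> card_lt [set: set T] [set: K].
Proof.
move=> slK ltTK.
have [k0|nK] := pselect (exists x : K, True); last first.
  case: ltTK => _ [].
  pose f k := False_rect T (nK (ex_intro _ k I)).
  by apply: (@card_leT_intro _ _ f) => k; case: (nK); exists k.
have {k0}[k0 _] := k0.
have [f [_ fi]] := card_le_ex k0 ltTK.1.
have {}slK : card_lt [set B : set K | B `<=` range f] [set: K].
  by apply: slK; apply: card_lt_le ltTK; exact: card_image_le.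
apply: card_lt_le slK; apply: (@card_le_intro _ _ _ _ (fun A => f @` A)).
  by move=> A _; exact: image_subset.
move=> A B _ _ AB; apply/seteqP; split=> x.
  move=> Ax; have : (f @` B) (f x) by rewrite -AB; exists x.
  by case=> y By /(fi _ _ I I) <-.
move=> Bx; have : (f @` A) (f x) by rewrite AB; exists x.
by case=> y Ay /(fi _ _ I I) <-.
Qed.

(** * Well-ordered subsets and the Hartogs construction *)

(* A well-ordered subset is determined by its set of closed initial segments. *)
Definition segments (X : Type) (p : rel X * pred X) : set (set X) :=
  [set D | exists2 y, p.2 y & D = [set x | p.2 x /\ p.1 x y]].

Lemma wo_subset_refl (X : Type) (p : rel X * pred X) x :
  wo_subset p -> p.2 x -> p.1 x x.
Proof. by move=> wp px; have := @wo_chain_reflexive {classic X} _ _ wp x px. Qed.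

Lemma wo_subset_anti (X : Type) (p : rel X * pred X) x y :
  wo_subset p -> p.2 x -> p.2 y -> p.1 x y -> p.1 y x -> x = y.
Proof.
move=> wp px py xy yx.
by apply: (@wo_chain_antisymmetric {classic X} _ _ wp x y px py); rewrite xy.
Qed.

Lemma wo_subset_total (X : Type) (p : rel X * pred X) x y :
  wo_subset p -> p.2 x -> p.2 y -> p.1 x y \/ p.1 y x.
Proof.
by move=> wp px py; have /orP := @wo_chainW {classic X} _ _ wp x y px py.
Qed.

Lemma wo_subset_min (X : Type) (p : rel X * pred X) (A : set X) :
  wo_subset p -> (forall x, A x -> p.2 x) -> A !=set0 ->
  exists2 z, A z & forall x, A x -> p.1 z x.
Proof.
move=> wp Ap [a Aa].
pose B : pred X := fun x => `[<A x>].
have [||z [[Az zmin] _]] := wp B.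
- by move=> x /asboolP/Ap.
- by exists a; apply/asboolP.
exists z; first exact/asboolP.
by move=> x Ax; apply: zmin; apply/asboolP.
Qed.

(** The least element of [[set x; y; z]] decides: if it is [y] or [z], antisymmetry identifies two
    of the three points. *)
Lemma wo_subset_trans (X : Type) (p : rel X * pred X) x y z :
  wo_subset p -> p.2 x -> p.2 y -> p.2 z -> p.1 x y -> p.1 y z -> p.1 x z.
Proof.
move=> wp px py pz xy yz.
have [||w wE wmin] := @wo_subset_min _ p [set x; y; z] wp.
- by move=> t [[->|->]|->].
- by exists x; left; left.
case: wE wmin => [[]|] -> wmin.
- by apply: wmin; right.
- have yx := wmin x (or_introl (or_introl erefl)).
  by rewrite (wo_subset_anti wp px py xy yx).
- have zy := wmin y (or_introl (or_intror erefl)).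
  by rewrite -(wo_subset_anti wp py pz yz zy).
Qed.

(** The identity is an isomorphism. By reflexivity the segments cover exactly the carrier. If [x] is
    below [y] in one order, the other order's segment ending at [y] is also a segment of the first;
    it contains [y], hence [x]. *)
Lemma segments_inj (X : Type) (p q : rel X * pred X) :
  wo_subset p -> wo_subset q -> segments p = segments q -> wo_isomorphic p q.
Proof.
have sub (r s : rel X * pred X) x : wo_subset r -> segments r = segments s ->
    r.2 x -> s.2 x.
  move=> wr rs rx.
  have : segments r [set y | r.2 y /\ r.1 y x] by exists x.
  rewrite rs => -[y sy E].
  have : [set y | r.2 y /\ r.1 y x] x by split=> //; apply: wo_subset_refl.
  by rewrite E => -[].
have le (r s : rel X * pred X) x y : wo_subset r -> wo_subset s ->
    segments r = segments s -> r.2 x -> r.2 y -> r.1 x y -> s.1 x y.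
  move=> wr ws rs rx ry xy.
  have sx := sub _ _ _ wr rs rx; have sy := sub _ _ _ wr rs ry.
  have : segments s [set z | s.2 z /\ s.1 z y] by exists y.
  rewrite -rs => -[z rz E].
  have : [set z | s.2 z /\ s.1 z y] y by split=> //; apply: wo_subset_refl.
  rewrite E => -[_ yz].
  have : [set x | r.2 x /\ r.1 x z] x by split=> //; apply: wo_subset_trans xy yz.
  by rewrite -E => -[].
move=> wp wq pq; exists idfun; split.
  suff -> : [set x | p.2 x] = [set x | q.2 x] by split=> //; exact: surj_id.
  by apply/seteqP; split=> x /=; apply: sub.
move=> x y px py; apply/idP/idP; last exact: le.
by apply: le => //; [exact: sub px|exact: sub py].
Qed.

Lemma wo_isomorphic_trans (X : Type) (p q r : rel X * pred X) :
  wo_isomorphic p q -> wo_isomorphic q r -> wo_isomorphic p r.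
Proof.
move=> [f [fb fm]] [g [gb gm]]; exists (g \o f); split; first exact: set_bij_comp gb.
by move=> x y px py /=; rewrite gm ?fm //; have [h _ _] := fb; apply: h.
Qed.

Lemma wo_isomorphic_sym (X : Type) (p q : rel X * pred X) :
  wo_isomorphic p q -> wo_isomorphic q p.
Proof.
move=> [f [[ff fi fs] fm]].
have /choice[g gP] y : exists x, q.2 y -> p.2 x /\ f x = y.
  have [qy|] := boolP (q.2 y); last by exists y.
  by have [x px <-] := fs _ qy; exists x.
exists g; split.
  split.
  - by move=> y /gP[].
  - move=> y z /set_mem /gP[_ {2}<-] /set_mem /gP[_ {2}<-] -> //.
  - move=> x px; exists (f x); first exact: ff.
    have [pg fg] := gP _ (ff _ px).
    by apply: fi fg; apply: mem_set.
move=> x y /gP[px xE] /gP[py yE].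
by rewrite -fm // xE yE.
Qed.

(** A class is coded by the set of the [segments] of its members. Two classes with the same code
    have members with equal [segments], hence isomorphic ones, and so coincide. *)
Lemma card_hartogs_le (X : Type) :
  [set: hartogs X] #<= [set: set (set (set X))].
Proof.
apply: (@card_leT_intro _ _ (fun C : hartogs X => @segments X @` sval C)).
move=> [C [p [wp CE]]] [D [q [wq DE]]] /= E; apply: eq_exist.
have refl r : wo_isomorphic (X := X) r r.
  by exists idfun; split=> //; split=> //; exact: surj_id.
have : (@segments X @` D) (segments p) by rewrite -E; exists p => //; rewrite CE.
case; rewrite DE => r [wr qr] rp.
have pq : wo_isomorphic p q.
  apply: (@wo_isomorphic_trans _ _ r); last exact: wo_isomorphic_sym.
  by apply: segments_inj.
rewrite CE; apply/seteqP; split=> s [ws ps]; split=> //.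
  exact: wo_isomorphic_trans (wo_isomorphic_sym pq) ps.
exact: wo_isomorphic_trans pq ps.
Qed.

Definition hartogs_class (X : Type) (p : rel X * pred X) (wp : wo_subset p) :
    hartogs X :=
  exist _ [set q | wo_subset q /\ wo_isomorphic p q]
    (ex_intro _ p (conj wp erefl)).

(* The least initial segment [D] of a well-ordering of [set X] that does not
   inject into [X] injects into [hartogs X] by [w |-> type of [set v | v < w]]. *)
Lemma hartogs_not_le (X : Type) : ~ ([set: hartogs X] #<= [set: X]).
Proof.
move=> HX.
(* The empty well-ordering inhabits [hartogs X], hence [X] too, which provides the default value
   [x0]. *)
have w0 : wo_subset (fun=> fun=> false, pred0 : pred X) by move=> A sA [x /sA].
pose h0 := hartogs_class w0.
have [x0 _] : exists x : X, True.
  by have /card_leP[f] := HX; exists (\val (f (exist _ h0 (mem_setT _)))).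
have [R wR] := well_ordering_principle {classic (set X)}.
set T := {classic (set X)} in R wR.
have {}wR : @wo_subset T (R, xpredT) by move=> A _; exact: wR.
have Rmin (A : set T) : A !=set0 -> exists2 z, A z & forall x, A x -> R z x.
  by apply: wo_subset_min wR _.
have Ranti x y : R x y -> R y x -> x = y by apply: wo_subset_anti wR _ _.
have Rtrans x y z : R x y -> R y z -> R x z by apply: wo_subset_trans wR _ _ _.
have Rtotal x y : R x y \/ R y x by apply: wo_subset_total wR _ _.
pose seg w : set T := [set v | R v w /\ v <> w].
pose D : set T := [set w | seg w #<= [set: X]].
(* If [D] omits a point, the least such [m] has [seg m] inside [D], so an injection of [D] into [X]
   would put [m] in [D]. If [D] is everything, Cantor's theorem applies. *)
have nDX : ~ (D #<= [set: X]).
  move=> DX; have [[w nDw]|allD] := pselect (exists w, ~ D w).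
    have [m nDm mmin] := Rmin [set w | ~ D w] (ex_intro (fun w => ~ D w) w nDw).
    apply: nDm; apply: card_le_trans DX; apply: subset_card_le => v [vm nvm].
    by apply: contrapT => nDv; apply: nvm; apply: Ranti (mmin _ nDv).
  apply: (@cantor X); apply: card_le_trans DX; apply: subset_card_le => w _.
  by apply: contrapT => nDw; apply: allD; exists w.
have /choice[j jP] (w : T) : exists j : T -> X, D w ->
    forall u v, seg w u -> seg w v -> j u = j v -> u = v.
  have [Dw|] := pselect (D w); last by exists (fun=> x0).
  by have [f [_ fi]] := card_le_ex x0 Dw; exists f.
(* The order of [seg w], carried over to a subset of [X] along the injection [j w]. *)
pose pt (w : T) : rel X * pred X :=
  (fun x y => `[< exists u v, [/\ seg w u, seg w v, j w u = x, j w v = y & R u v] >],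
   fun x => `[< exists2 u, seg w u & j w u = x >]).
have ptE w u v : D w -> seg w u -> seg w v -> (pt w).1 (j w u) (j w v) = R u v.
  move=> Dw wu wv; apply/asboolP/idP => [[u' [v' [wu' wv' uE vE uv]]]|uv].
    by rewrite -(jP w Dw _ _ wu' wu uE) -(jP w Dw _ _ wv' wv vE).
  by exists u, v.
have wpt w : D w -> wo_subset (pt w).
  move=> Dw; apply: antisymmetric_wo_chain => [x y|A sA [x Ax]].
    move=> /asboolP[u wu <-] /asboolP[v wv <-]; rewrite !ptE // => /andP[uv vu].
    by rewrite (Ranti _ _ uv vu).
  have /sA/asboolP[u wu uE] := Ax.
  have [|m [wm Am] mmin] := Rmin [set u | seg w u /\ j w u \in A].
    by exists u; rewrite /= uE.
  exists (j w m); split=> // y Ay.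
  have /sA/asboolP[v wv vE] := Ay.
  by rewrite -vE ptE //; apply: mmin; rewrite /= vE.
(* An isomorphism would induce a monotone [phi] from [seg v] to [seg w], which moves [w] down. The
   least point [m] moved down is refuted by [phi m], which is smaller and also moved down. *)
have niso v w : D v -> D w -> R w v -> w <> v -> wo_isomorphic (pt v) (pt w) -> False.
  move=> Dv Dw wv nwv [f [[ff _ _] fm]].
  have jv u : seg v u -> (pt v).2 (j v u) by move=> vu; apply/asboolP; exists u.
  have /choice[phi phiP] u : exists u', seg v u -> seg w u' /\ j w u' = f (j v u).
    have [vu|] := pselect (seg v u); last by exists u.
    by have /asboolP[u' wu' E] := ff _ (jv _ vu); exists u'.
  have phim u1 u2 : seg v u1 -> seg v u2 -> R (phi u1) (phi u2) = R u1 u2.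
    move=> v1 v2; have [w1 E1] := phiP _ v1; have [w2 E2] := phiP _ v2.
    by rewrite -(ptE w) // E1 E2 fm ?ptE //; exact: jv.
  have vw : seg v w by [].
  have [|m [vm [mR mne]] mmin] := Rmin [set u | seg v u /\ (R (phi u) u /\ phi u <> u)].
    by exists w; split=> //; have [] := phiP _ vw.
  have vphi : seg v (phi m).
    split; first by apply: Rtrans mR vm.1.
    by move=> E; apply: vm.2; apply: Ranti vm.1 _; rewrite -E.
  apply: (mne); apply: (Ranti _ _ mR); apply: mmin; split=> //; split.
    by rewrite phim.
  by move=> E; apply: mne; apply: (Ranti _ _ mR); rewrite -phim // E -{1}E phim.
have /choice[F FP] (w : T) : exists h : hartogs X,
    D w -> sval h = [set q | wo_subset q /\ wo_isomorphic (pt w) q].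
  have [Dw|] := pselect (D w); last by exists h0.
  by exists (hartogs_class (wpt w Dw)).
apply: nDX; apply: card_le_trans HX.
apply: (@card_le_intro _ _ _ _ F) => // v w Dv Dw FE.
have iso u u' : D u -> D u' -> F u = F u' -> wo_isomorphic (pt u) (pt u').
  move=> Du Du' E.
  suff : sval (F u) (pt u') by rewrite (FP _ Du) => -[].
  rewrite E (FP _ Du'); split; first exact: wpt.
  by exists idfun; split=> //; split=> //; exact: surj_id.
apply: contrapT => nvw; have [vw|wv] := Rtotal v w.
  by apply: (niso w v) => //; apply: iso.
by apply: (niso v w) => //; [move=> /esym|apply: iso].
Qed.

(** * Alephs, regularity and inaccessibility *)

Lemma existT_inj (T : Type) (P : T -> Type) x (u v : P x) :
  existT P x u = existT P x v -> u = v.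
Proof.
by move=> E; have := projT2_eq E; rewrite (Prop_irrelevance (projT1_eq E) erefl).
Qed.

(** [regular_card] only takes families indexed by a subset of [K], so [I] is first injected into [K]
    and the family reindexed along [phi]. *)
Lemma regular_no_cover (K T : Type) (I : set T) (F : T -> set K) :
  regular_card K -> card_lt I [set: K] ->
  (forall i, I i -> card_lt (F i) [set: K]) ->
  (forall k, exists2 i, I i & F i k) -> False.
Proof.
move=> [Kinf Kreg] IK FK Fcov.
have /infinite_setN0[k0 _] := Kinf.
have [phi [_ phii]] := card_le_ex k0 IK.1.
pose G k : set K := [set x | exists2 i, I i & phi i = k /\ F i x].
have [] := Kreg (phi @` I) G.
- by apply: card_lt_le IK; exact: card_image_le.
- move=> _ [i Ii <-]; apply: card_lt_le (FK i Ii); apply: subset_card_le.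
  by move=> x [i' Ii' [/(phii _ _ Ii' Ii) ->]].
move=> _ []; apply: subset_card_le => k _.
by have [i Ii Fik] := Fcov k; exists (phi i); [exists i|exists i].
Qed.

Section Aleph.
Variables (d : Order.disp_t) (Ord : wellOrderType d).
Implicit Types a b c : Ord.

Definition aleph_layer a : Type :=
  (nat + {b : Ord & {lt_ba : b < a & hartogs (aleph b)}})%type.

Lemma aleph_layerE a : aleph a = aleph_layer a.
Proof.
rewrite /aleph Fix_eq // => b f g fg; suff -> : f = g by [].
by apply: functional_extensionality_dep => c; apply: functional_extensionality_dep.
Qed.

Lemma aleph_layer_bij a : exists f : aleph_layer a -> aleph a, bijective f.
Proof. by rewrite aleph_layerE; exists idfun; exists idfun. Qed.

(** The inclusion of summands, made independent of the proofs of [c < b] by proof irrelevance. The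
    two range clauses let later arguments cover [aleph a] by copies of smaller alephs. *)
Lemma aleph_embed b a (f : aleph_layer a -> aleph a) : bijective f -> b < a ->
  exists m : aleph b -> aleph a, [/\ injective m, forall n, range m (f (inl n)) &
    forall c (ca : c < a) h, c < b ->
      range m (f (inr (existT _ c (existT _ ca h))))].
Proof.
move=> /bij_inj fi ltba; have [g [g' gK g'K]] := aleph_layer_bij b.
pose m (x : aleph_layer b) : aleph_layer a := match x with
  | inl n => inl n
  | inr (existT c (existT p h)) => inr (existT _ c (existT _ (lt_trans p ltba) h))
  end.
pose m' (x : aleph_layer a) : option (aleph_layer b) := match x with
  | inl n => Some (inl n)
  | inr (existT c (existT _ h)) =>
      if @idP (c < b) is ReflectT p then Some (inr (existT _ c (existT _ p h)))
      else None
  end.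
have mK : pcancel m m'.
  case=> // -[c [p h]] /=; case: {-}_ / idP => // p'.
  by rewrite (Prop_irrelevance p p').
exists (f \o m \o g'); split.
- by move=> x y /= /fi /(pcan_inj mK) /(can_inj g'K).
- by move=> n; exists (g (inl n)) => //=; rewrite gK.
- move=> c ca h cb; exists (g (inr (existT _ c (existT _ cb h)))) => //=.
  by rewrite gK /= (Prop_irrelevance (lt_trans _ _) ca).
Qed.

Lemma card_lt_aleph b a : b < a -> card_lt [set: aleph b] [set: aleph a].
Proof.
move=> ltba; have [f fb] := aleph_layer_bij a.
have [m [mi _ _]] := aleph_embed fb ltba.
split; first exact: card_leT_intro mi.
move=> ab; apply: (@hartogs_not_le (aleph b)); apply: card_le_trans ab.
apply: (@card_leT_intro _ _
  (fun h => f (inr (existT _ b (existT _ ltba h))))) => x y /(bij_inj fb) [].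
exact: existT_inj.
Qed.

(** At zero only the [nat] summand remains, which is countable. At a successor of [b], a copy of
    [aleph b] and the summand [hartogs (aleph b)] cover everything; the latter embeds in a triple
    power set of [aleph b], hence is small, and regularity is violated. *)
Lemma inaccessible_limit (lambda : Ord) :
  strongly_inaccessible (aleph lambda) -> ord_limit lambda.
Proof.
move=> [unc reg sl]; have [f fb] := aleph_layer_bij lambda.
have [g fK gK] := fb; split=> [z|b [ltbl bmax]].
  apply: unc; apply: (@card_leT_intro _ _
    (fun x => if g x is inl n then n else 0%N)) => x y.
  move=> E; rewrite -(gK x) -(gK y); move: E.
  have nosucc c : c < lambda -> False by move=> /lt_geF; rewrite z.
  case: (g x) => [n|[c [p h]]]; last by case: (nosucc _ p).
  by case: (g y) => [n' ->|[c [p h]]] //; case: (nosucc _ p).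
have [m [mi m1 m2]] := aleph_embed fb ltbl.
pose top h := f (inr (existT _ b (existT _ ltbl h))).
apply: (@regular_no_cover _ bool setT (fun i => if i then range m else range top) reg).
- have Kinf := reg.1.
  split; first by apply: card_le_trans (countableP _) _; apply/infiniteP.
  move=> Kb; apply: Kinf; apply: card_le_finite Kb _.
  exact: finite_finset.
- move=> [] _.
    by apply: card_lt_le (card_lt_aleph ltbl); exact: card_image_le.
  apply: card_lt_le (card_image_le _ _) _.
  apply: card_lt_le (card_hartogs_le _) _.
  by do 3!apply: (card_lt_set sl); exact: card_lt_aleph.
move=> k; rewrite -(gK k); case: (g k) => [n|[c [p h]]]; first by exists true.
have [cb|] := ltP c b; first by exists true => //; apply: m2.
rewrite le_eqVlt => /predU1P[E|/bmax lc]; last by have := lt_le_trans p lc; rewrite ltxx.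
subst c; exists false => //; exists h => //.
by rewrite /top (Prop_irrelevance ltbl p).
Qed.

(** If the values [g i] were unbounded, the copies of the [aleph (g i)] would cover [aleph lambda]
    by fewer than [aleph lambda] smaller sets. Each [F i] lies inside such a copy. *)
Lemma inaccessible_bounded (lambda : Ord) (T : Type) (I : set T) (g : T -> Ord) :
  strongly_inaccessible (aleph lambda) -> card_lt I [set: aleph lambda] ->
  (forall i, I i -> g i < lambda) ->
  exists2 a, a < lambda & forall i, I i -> g i <= a.
Proof.
move=> Kin IK gl; have [[nz _] [_ reg _]] := (inaccessible_limit Kin, Kin).
apply: contrapT => nb.
have unb a : a < lambda -> exists2 i, I i & a < g i.
  move=> al; apply: contrapT => na; apply: nb; exists a => // i Ii.
  by rewrite leNgt; apply/negP => ag; apply: na; exists i.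
have [f fb] := aleph_layer_bij lambda; have [f' fK f'K] := fb.
pose F i : set (aleph lambda) := [set k | match f' k with
  | inl _ => True | inr (existT c _) => c < g i end].
apply: (@regular_no_cover _ _ I F reg IK) => [i Ii|k].
  have [m [_ m1 m2]] := aleph_embed fb (gl i Ii).
  apply: card_lt_le (card_lt_aleph (gl i Ii)).
  apply: card_le_trans (card_image_le m _); apply: subset_card_le => k.
  by rewrite /F /= -{2}(f'K k); case: (f' k) => [n _|[c [cl h]]]; [exact: m1|exact: m2].
rewrite /F /=; case: (f' k) => [n|[c [cl h]]]; last exact: unb.
(* An element of the [nat] summand lies in every [F i], so some member of [I] has to be produced;
   unboundedness above any [z < lambda] gives one. *)
have [z zl] : exists z, z < lambda.
  apply: contrapT => nl; apply: nz => z; rewrite leNgt; apply/negP => zl.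
  by apply: nl; exists z.
by have [i Ii _] := unb z zl; exists i.
Qed.

End Aleph.

Lemma aleph_infinite (d : Order.disp_t) (Ord : wellOrderType d) (a : Ord) :
  infinite_set [set: aleph a].
Proof.
apply/infiniteP; have [f /bij_inj fi] := aleph_layer_bij a.
by apply: (@card_leT_intro _ _ (fun n => f (inl n))) => m n /fi[].
Qed.

Lemma card_lt_finite (T U : Type) (A : set T) (B : set U) :
  finite_set A -> infinite_set B -> card_lt A B.
Proof.
move=> Afin Binf; split; last by move=> /card_le_finite /(_ Afin).
by apply: card_le_trans (finite_set_countable Afin) _; apply/infiniteP.
Qed.

(** * Orders read in either direction, and well-ordered indices *)

(* [dlt true] is [<] and [dlt false] is [>], so that statements about [dlt s]
   treat both sides of a gap at once. *)
Definition dlt (s : bool) (d : Order.disp_t) (X : orderType d) (x y : X) : bool :=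
  if s then x < y else y < x.

Section Dlt.
Variables (s : bool) (d : Order.disp_t) (X : orderType d).
Implicit Types x y z : X.

Lemma dlt_trans y x z : dlt s x y -> dlt s y z -> dlt s x z.
Proof. by case: s => [|/[swap]]; apply: lt_trans. Qed.

Lemma dltxx x : dlt s x x = false.
Proof. by case: s; apply: ltxx. Qed.

Lemma dlt_neg x y : ~ dlt s x y -> x = y \/ dlt s y x.
Proof. by rewrite /dlt; case: s; case: ltgtP => //; auto. Qed.

End Dlt.

Section WellOrder.
Variables (d : Order.disp_t) (Ord : wellOrderType d).
Implicit Types a b c : Ord.

Lemma wo_min (P : set Ord) : P !=set0 -> exists2 m, P m & forall b, P b -> m <= b.
Proof.
move=> [a Pa]; elim/(well_founded_ind (@wo_wf _ Ord)): a Pa => a IH Pa.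
have [[b [Pb ba]]|nb] := pselect (exists b, P b /\ b < a); first exact: IH Pb.
exists a => // b Pb; rewrite leNgt; apply/negP => ba.
by apply: nb; exists b.
Qed.

Lemma ord_succ_ex b a : b < a -> exists2 c, ord_succ b c & c <= a.
Proof.
move=> ba; have [c bc cmin] := @wo_min [set c | b < c] (ex_intro _ a ba).
by exists c; [split|apply: cmin].
Qed.

Lemma ord_succ_le b c a : ord_succ b c -> a < c -> a <= b.
Proof. by move=> [bc cmin] ac; rewrite leNgt; apply/negP => /cmin; rewrite leNgt ac. Qed.

Variant ord_spec a : Prop :=
  | OrdZero of ord_zero a
  | OrdSucc b of ord_succ b a
  | OrdLimit of ord_limit a.

Lemma ordP a : ord_spec a.
Proof.
have [/OrdZero//|nz] := pselect (ord_zero a).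
have [[b /OrdSucc//]|ns] := pselect (exists b, ord_succ b a).
by apply: OrdLimit; split=> // b bs; apply: ns; exists b.
Qed.

Lemma ord_limit_ex a : ord_limit a -> exists b, b < a.
Proof.
move=> [nz _]; apply: contrapT => nb; apply: nz => b.
by rewrite leNgt; apply/negP => ba; apply: nb; exists b.
Qed.

Lemma ord_limit_succ b a : ord_limit a -> b < a -> exists2 c, ord_succ b c & c < a.
Proof.
move=> [_ ns] ba; have [c bc ca] := ord_succ_ex ba; exists c => //.
by rewrite lt_neqAle ca andbT; apply/eqP => E; apply: (ns b); rewrite -E.
Qed.

End WellOrder.

(** * Dense orders without end points *)

Definition dense_unbounded (d : Order.disp_t) (X : orderType d) : Prop :=
  [/\ exists x : X, True, forall s (x : X), exists y, dlt s x y &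
      forall x y : X, x < y -> exists z, x < z < y].

(** Every aleph is infinite, so empty sets and singletons may be the sides of a gap. These
    first-order consequences are what ultrapowers and direct limits preserve. *)
Lemma eta_set_dense (dO : Order.disp_t) (Ord : wellOrderType dO) (z : Ord)
    (d : Order.disp_t) (X : orderType d) :
  eta_set z X -> dense_unbounded X.
Proof.
move=> eta.
have fill (L R : set X) : finite_set L -> finite_set R -> set_lt L R ->
    exists a : X, set_lt L [set a] /\ set_lt [set a] R.
  by move=> Lf Rf; apply: eta; apply: card_lt_finite => //; exact: aleph_infinite.
split.
- by have [x _] := fill set0 set0 (finite_set0 _) (finite_set0 _) (fun x y => False_rect _);
  exists x.
- case=> x.
    have [//|y [xy _]] := fill [set x] set0 (finite_set1 _) (finite_set0 _).
    by exists y; apply: xy.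
  have [//|y [_ yx]] := fill set0 [set x] (finite_set0 _) (finite_set1 _).
  by exists y; apply: yx.
move=> x y xy.
have [|t [xt ty]] := fill [set x] [set y] (finite_set1 _) (finite_set1 _).
  by move=> _ _ -> ->.
by exists t; rewrite xt // ty.
Qed.

(** * The order of an ultrapower *)

Section Ultrapower.
Variables (S : signature) (d : Order.disp_t) (I : Type) (U : set_system I).
Variables (X Z : loStructure S d) (cls : (I -> X) -> Z).
Hypotheses (uU : UltraFilter U) (up : is_ultrapower U cls).

(** Strict inequality is the negation of the reversed [<=], and an ultrafilter contains a set or its
    complement. *)
Lemma ultrapower_dlt s f g :
  dlt s (cls f) (cls g) <-> U [set i | dlt s (f i) (g i)].
Proof.
have lt u v : cls u < cls v <-> U [set i | u i < v i].
  rewrite ltNge; split=> [/negP nvu|uv].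
    have [vu|] := in_ultra_setVsetC [set i | v i <= u i] uU.
      by case: nvu; apply/(ultrapower_le up).
    by apply: filterS => i /= /negP; rewrite -ltNge.
  apply/negP => /(ultrapower_le up) vu.
  have [i [/= iuv ivu]] := filter_ex (filterI uv vu).
  by have := lt_le_trans iuv ivu; rewrite ltxx.
by case: s; exact: lt.
Qed.

Lemma ultrapower_le_const (x y : X) :
  (cls (fun=> x) <= cls (fun=> y)) = (x <= y).
Proof.
apply/idP/idP => [/(ultrapower_le up)|xy]; first by move=> /filter_ex[].
by apply/(ultrapower_le up); apply: filterS filterT.
Qed.

Lemma ultrapower_dense : dense_unbounded X -> dense_unbounded Z.
Proof.
move=> [[x0 _] unb dense]; split; first by exists (cls (fun=> x0)).
  move=> s z; have [f <-] := ultrapower_onto up z.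
  have /choice[g gP] i : exists y, dlt s (f i) y by exact: unb.
  by exists (cls g); apply/ultrapower_dlt; apply: filterS filterT => i _; exact: gP.
move=> z1 z2; have [f <-] := ultrapower_onto up z1; have [g <-] := ultrapower_onto up z2.
move=> /(ultrapower_dlt true) fg.
have /choice[h hP] i : exists y, f i < g i -> f i < y < g i.
  have [/dense[y fyg]|_] := boolP (f i < g i); first by exists y.
  by exists x0.
exists (cls h); apply/andP; split; apply/(ultrapower_dlt true);
  by apply: filterS fg => i /hP/andP[].
Qed.

End Ultrapower.

(** * Embeddings between the stages *)

Section Hierarchy.
Variables (dO : Order.disp_t) (Ord : wellOrderType dO) (lambda : Ord).
Variables (S : signature) (d : Order.disp_t) (A : loStructure S d).
Variable Y : ultrapower_hierarchy A lambda.
Implicit Types a b c : Ord.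

Local Notation X := (stage Y).
Local Notation e := (emb Y).

Lemma emb_comp a b c (x : X a) : a <= b -> b <= c -> c <= lambda ->
  e b c (e a b x) = e a c x.
Proof.
move=> ab; elim/(well_founded_ind (@wo_wf _ Ord)): c => c IH.
rewrite le_eqVlt => /predU1P[<- bl|bc cl]; first exact: emb_id.
have [/(_ b)|c' cc'|climit] := ordP c; first by rewrite leNgt bc.
- have bc' := ord_succ_le cc' bc.
  rewrite !(emb_succ Y _ cc') //; last exact: le_trans bc'.
  congr (hclass _ _ _ _); apply: funext => _.
  by apply: IH => //; [case: cc'|apply: le_trans cl; apply: ltW; case: cc'].
by have [coc _ _ _ _ _] := stage_limit Y climit cl; apply: coc.
Qed.

(** At a successor, classes of constants compare as their values. At a limit, a comparison already
    holds at some earlier stage, where the induction hypothesis applies. *)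
Lemma emb_le a c (x y : X a) : a <= c -> c <= lambda ->
  (e a c x <= e a c y) = (x <= y).
Proof.
elim/(well_founded_ind (@wo_wf _ Ord)): c => c IH.
rewrite le_eqVlt => /predU1P[<- al|ac cl]; first by rewrite !emb_id.
have [/(_ a)|c' cc'|climit] := ordP c; first by rewrite leNgt ac.
- have ac' := ord_succ_le cc' ac.
  have c'l : c' < lambda by apply: lt_le_trans cl; case: cc'.
  rewrite !(emb_succ Y _ cc') //.
  rewrite (ultrapower_le_const (ultra_ultrafilter Y c'l) (stage_succ Y cc' cl)).
  by apply: IH => //; [case: cc'|exact: ltW].
have [_ _ _ dle _ _] := stage_limit Y climit cl.
apply/idP/idP => [/(dle _ _ _ _ ac ac)[g [ag _ gc]]|xy].
  by rewrite IH //; apply: le_trans cl; exact: ltW.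
apply/(dle _ _ _ _ ac ac); exists a.
by rewrite !emb_id //; apply: le_trans cl; exact: ltW.
Qed.

Lemma emb_dlt s a c (x y : X a) : a <= c -> c <= lambda ->
  dlt s (e a c x) (e a c y) = dlt s x y.
Proof. by move=> ac cl; case: s; rewrite /dlt !ltNge emb_le. Qed.

Lemma emb_lt a c (x y : X a) : a <= c -> c <= lambda ->
  (e a c x < e a c y) = (x < y).
Proof. exact: (emb_dlt true). Qed.

Lemma emb_inj a c : a <= c -> c <= lambda -> injective (e a c).
Proof.
move=> ac cl x y E; apply: le_anti.
by rewrite -!(emb_le _ _ ac cl) E lexx.
Qed.

Lemma stage_dense c : dense_unbounded A -> c <= lambda -> dense_unbounded (X c).
Proof.
move=> Ad; elim/(well_founded_ind (@wo_wf _ Ord)): c => c IH cl.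
have [czero|c' cc'|climit] := ordP c; first by rewrite stage_zero.
- have c'l : c' < lambda by apply: lt_le_trans cl; case: cc'.
  apply: (ultrapower_dense (ultra_ultrafilter Y c'l) (stage_succ Y cc' cl)).
  by apply: IH; [case: cc'|exact: ltW].
have [_ onto _ _ _ _] := stage_limit Y climit cl.
have {}IH b : b < c -> dense_unbounded (X b).
  by move=> bc; apply: IH => //; apply: le_trans cl; exact: ltW.
split.
- have [b /[dup] bc /IH[[x _] _ _]] := ord_limit_ex climit.
  by exists (e b c x).
- move=> s z; have [b [bc [x <-]]] := onto z.
  have [_ /(_ s x)[y xy] _] := IH b bc.
  by exists (e b c y); rewrite emb_dlt // ltW.
move=> z z'; have [b [bc [x <-]]] := onto z; have [b' [bc' [x' <-]]] := onto z'.
(* Two points of a limit stage are moved to a common earlier stage, whose density gives the point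
   between. *)
have mc : Order.max b b' < c by rewrite gt_max bc bc'.
rewrite -[emb _ b c x](@emb_comp b (Order.max b b')) ?le_max ?lexx ?orbT ?(ltW mc) //.
rewrite -[emb _ b' c x'](@emb_comp b' (Order.max b b')) ?le_max ?lexx ?orbT ?(ltW mc) //.
rewrite emb_lt ?(ltW mc) // => xx'.
have [_ _ /(_ _ _ xx')[y /andP[xy yx']]] := IH _ mc.
by exists (e _ c y); rewrite !emb_lt ?(ltW mc) //; apply/andP.
Qed.

Hypothesis tails : forall b : Ord, b < lambda -> tails_ultrafilter (ultra Y b).
Hypothesis A_dense : dense_unbounded A.

(* The class of the identity is above all constants, since [ultra Y b] contains
   all tails. *)
Lemma stage_above b c : ord_succ b c -> c <= lambda ->
  exists w : X c, forall y : X b, e b c y < w.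
Proof.
move=> bc cl; have bl : b < lambda by apply: lt_le_trans cl; case: bc.
have [uU tU] := tails bl; exists (hclass Y b c id) => y.
rewrite (emb_succ Y _ bc cl (lexx b)) emb_id ?ltW //.
apply/(ultrapower_dlt uU (stage_succ Y bc cl) true).
(* Tails are closed at their lower end, so strictness requires the tail of some [y'] beyond [y]. *)
have [_ /(_ true y)[y' yy'] _] := stage_dense A_dense (ltW bl).
by apply: filterS (tU y') => j /=; apply: lt_le_trans.
Qed.

(** * Filling gaps in the last stage *)

Hypothesis inaccessible : strongly_inaccessible (aleph lambda).

Let limitl : ord_limit lambda := inaccessible_limit inaccessible.

(* A strictly [dlt s]-increasing sequence in [L], indexed by the ordinals from
   [a] on, gets stuck at some [c < lambda], where it is cofinal in [L]. *)
Lemma cofinal_sequence s a (L : set (X a)) : a < lambda ->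
  card_lt L [set: aleph lambda] -> L !=set0 ->
  (forall l, L l -> exists2 l', L l' & dlt s l l') ->
  exists c (G : Ord -> X a), [/\ ord_limit c, a < c, c < lambda,
    forall b, a <= b -> b < c -> L (G b) /\
      forall b', a <= b' -> b' < b -> dlt s (G b') (G b) &
    forall l, L l -> exists b, [/\ a <= b, b < c & dlt s l (G b)]].
Proof.
move=> al Lsmall [l0 Ll0] nomax.
(* The next term is any member of [L] beyond all earlier terms; [l0] is a default for when there is
   none. *)
pose H c (rec : forall b, b < c -> X a) : X a :=
  xget l0 [set l | L l /\ forall b (bc : b < c), a <= b -> dlt s (rec b bc) l].
pose G := Fix (@wo_wf _ Ord) (fun=> X a) H.
pose Q c : set (X a) := [set l | L l /\ forall b, b < c -> a <= b -> dlt s (G b) l].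
have GE c : G c = xget l0 (Q c).
  rewrite /G Fix_eq // => b f g fg; suff -> : f = g by [].
  by apply: functional_extensionality_dep => t; apply: functional_extensionality_dep.
have QG c : (exists l, Q c l) -> Q c (G c).
  by move=> [l Ql]; rewrite GE; apply: xgetPex; exists l.
have [c [ac cl nQ] cmin] :
    exists2 c, [/\ a <= c, c < lambda & ~ exists l, Q c l] &
      forall b, a <= b -> b < c -> exists l, Q b l.
  have [|c [ac cl nQ] cmin] :=
      @wo_min _ _ [set c | [/\ a <= c, c < lambda & ~ exists l, Q c l]].
    apply: contrapT => nstuck.
    have {}QG c : a <= c -> c < lambda -> Q c (G c).
      move=> ac cl; apply: QG; apply: contrapT => nQ.
      by apply: nstuck; exists c.
    (* A sequence that never got stuck would be injective; its inverse [g] would then map the small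
       set [L] onto an unbounded set of ordinals below [lambda]. *)
    pose g l := xget a [set c | [/\ a <= c, c < lambda & G c = l]].
    have gG c : a <= c -> c < lambda -> g (G c) = c.
      move=> ac cl; rewrite /g.
      have [b _ [ab bl E]|/(_ c)[]//] := xgetP a.
      have := QG c ac cl; have := QG b ab bl; move=> [_ Qb] [_ Qc].
      case: (ltgtP b c) => // [bc|cb].
        by have := Qc b bc ab; rewrite E dltxx.
      by have := Qb c cb ac; rewrite E dltxx.
    have [|a' a'l gle] := inaccessible_bounded (I := L) (g := g) inaccessible Lsmall.
      move=> l _; rewrite /g; have [b _ [_ bl _]|_] := xgetP a; first exact: bl.
      exact: al.
    have ml : Order.max a a' < lambda by rewrite gt_max al a'l.
    have [c [mc _] cl] := ord_limit_succ limitl ml.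
    move: mc; rewrite gt_max => /andP[ac a'c].
    have := gle (G c) (QG c (ltW ac) cl).1; rewrite gG //; last exact: ltW.
    by rewrite leNgt a'c.
  exists c => // b ab bc; apply: contrapT => nQb.
  by have := cmin b (And3 ab (lt_trans bc cl) nQb); rewrite leNgt bc.
(* No member of [L] is beyond all terms before [c]. Applied to some [l'] beyond [l], this gives a
   term at or beyond [l'], hence strictly beyond [l]. *)
have cof l : L l -> exists b, [/\ a <= b, b < c & dlt s l (G b)].
  move=> Ll; have [l' Ll' ll'] := nomax l Ll.
  apply: contrapT => nb; apply: nQ; exists l'; split=> // b bc ab.
  apply: contrapT => /dlt_neg bl'; apply: nb; exists b; split=> //.
  by case: bl' => [->//|]; apply: dlt_trans.
have ltac : a < c.
  by have [b [ab bc _]] := cof l0 Ll0; apply: le_lt_trans bc.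
exists c, G; split=> //.
- split; first by move=> /(_ a); rewrite leNgt ltac.
  (* If [c] were the successor of [b], a member of [L] beyond [G b] would continue the sequence at
     [c]. *)
  move=> b bc; have ab := ord_succ_le bc ltac.
  have [Lb Gb] := QG b (cmin b ab bc.1).
  have [l' Ll' bl'] := nomax _ Lb; apply: nQ; exists l'; split=> // b' b'c ab'.
  have := ord_succ_le bc b'c; rewrite le_eqVlt => /predU1P[->//|b'b].
  by apply: dlt_trans bl'; exact: Gb.
- move=> b ab bc; have [Lb Gb] := QG b (cmin b ab bc).
  by split=> // b' ab' b'b; apply: Gb.
Qed.

Lemma fill_gap s a (L : set (X a)) : a < lambda ->
  card_lt L [set: aleph lambda] -> L !=set0 ->
  (forall l, L l -> exists2 l', L l' & dlt s l l') ->
  exists w : X lambda, (forall l, L l -> dlt s (e a lambda l) w) /\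
    forall r, (forall l, L l -> dlt s l r) -> dlt s w (e a lambda r).
Proof.
move=> al Lsmall L0 nomax.
have [c [G [climit ac cl GP Gcof]]] := cofinal_sequence al Lsmall L0 nomax.
have [_ onto _ _ _ _] := stage_limit Y climit (ltW cl).
(* Taking the maximum with [a] keeps [rk x] in the range of indices where [G] is known to lie in [L]
   and to be monotone. *)
have /choice[rk rkP] (x : X c) : exists b, [/\ a <= b, b < c & range (e b c) x].
  have [b [bc [y <-]]] := onto x.
  have mc : Order.max a b < c by rewrite gt_max ac bc.
  exists (Order.max a b); split; rewrite ?le_max ?lexx //; exists (e b _ y) => //.
  by rewrite emb_comp ?le_max ?lexx ?orbT ?(ltW mc) ?(ltW cl).
have [c' cc' c'l] := ord_limit_succ limitl cl.
have ac' : a <= c' by apply: ltW; apply: lt_trans ac _; case: cc'.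
pose f (x : X c) : X c := e a c (G (rk x)).
have uU := ultra_ultrafilter Y cl.
have up := stage_succ Y cc' (ltW c'l).
(* Points of stage [a] become classes of constants, so they can be compared with the class of [f]
   coordinatewise. *)
have constE (x : X a) : e a lambda x = e c' lambda (hclass Y c c' (fun=> e a c x)).
  by rewrite -(emb_succ Y x cc' (ltW c'l) (ltW ac)) emb_comp ?(ltW c'l).
exists (e c' lambda (hclass Y c c' f)); split=> [l Ll|r Lr]; last first.
  rewrite constE emb_dlt ?(ltW c'l) //; apply/(ultrapower_dlt uU up).
  apply: filterS filterT => x _ /=; rewrite /f emb_dlt ?(ltW ac) ?(ltW cl) //.
  have [ab bc _] := rkP x.
  by apply: Lr; have [] := GP _ ab bc.
rewrite constE emb_dlt ?(ltW c'l) //; apply/(ultrapower_dlt uU up).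
have [b [ab bc lb]] := Gcof l Ll.
(* The tail goes upwards for both values of [s], since only the stage where [x] occurs matters. As
   [w] exceeds all of stage [b], any [x] at or above its image has [rk x] beyond [b], so [G (rk x)]
   is beyond [G b] and [l]. *)
have [b' bb' b'c] := ord_limit_succ climit bc.
have b'l := lt_trans b'c cl.
have [w wP] := stage_above bb' (ltW b'l).
have [_ tU] := tails cl.
apply: filterS (tU (e b' c w)) => x /= wx; rewrite /f emb_dlt ?(ltW ac) ?(ltW cl) //.
have [rk_a rk_c [y _ yx]] := rkP x.
have rk_gt : b < rk x.
  rewrite ltNge; apply/negP => rb.
  have := wP (e (rk x) b y); rewrite -(emb_lt _ _ (ltW b'c) (ltW cl)).
  rewrite !emb_comp ?(ltW cl) ?(ltW b'c) ?(ltW bc) ?(ltW bb'.1) //.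
  rewrite yx => xw; have := lt_le_trans xw wx.
  by rewrite ltxx.
by apply: dlt_trans lb _; have [_] := GP _ rk_a rk_c; apply.
Qed.

Lemma hierarchy_eta : eta_set lambda (X lambda).
Proof.
move=> L R Lsmall Rsmall LR.
have [_ onto _ _ _ _] := stage_limit Y limitl (lexx _).
have /choice[st stP] (x : X lambda) : exists b, b < lambda /\ range (e b lambda) x.
  by have [b [bl [y yx]]] := onto x; exists b; split=> //; exists y.
have [|aL aLl aLP] := inaccessible_bounded (g := st) inaccessible Lsmall.
  by move=> x _; have [] := stP x.
have [|aR aRl aRP] := inaccessible_bounded (g := st) inaccessible Rsmall.
  by move=> x _; have [] := stP x.
pose a := Order.max aL aR.
have al : a < lambda by rewrite gt_max aLl.
have low x : st x <= a -> exists y, e a lambda y = x.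
  have [bl [y _ yx]] := stP x; move=> ba.
  by exists (e _ a y); rewrite emb_comp ?yx ?(ltW al).
have lowL x : L x -> exists y, e a lambda y = x.
  by move=> /aLP xa; apply: low; rewrite le_max xa.
have lowR x : R x -> exists y, e a lambda y = x.
  by move=> /aRP xa; apply: low; rewrite le_max xa orbT.
have pull (B : set (X lambda)) : card_lt B [set: aleph lambda] ->
    card_lt [set y | B (e a lambda y)] [set: aleph lambda].
  apply: card_lt_le; apply: (@card_le_intro _ _ _ _ (e a lambda)) => // x y _ _.
  exact: (@emb_inj a lambda (ltW al) (lexx lambda)).
(* Used for [L] with [s = true], and for [R] with [s = false] and the sides exchanged. When [B] is
   inhabited without an extreme element towards [C], [fill_gap] applies to its preimage in stage
   [a]. *)
have gap s (B C : set (X lambda)) : card_lt B [set: aleph lambda] ->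
    (forall x, B x -> exists y, e a lambda y = x) ->
    (forall x, C x -> exists y, e a lambda y = x) ->
    (forall x y, B x -> C y -> dlt s x y) ->
    (exists2 w, (forall x, B x -> dlt s x w) & (forall y, C y -> dlt s w y)) \/
    (B = set0 \/ exists2 m, B m & forall x, B x -> x = m \/ dlt s x m).
  move=> Bsmall lowB lowC BC.
  have [[x Bx]|B0] := pselect (B !=set0); last first.
    right; left; apply/seteqP; split=> // x Bx.
    by apply: B0; exists x.
  have [mB|nomax] := pselect (exists2 m, B m & forall x, B x -> x = m \/ dlt s x m).
    by right; right.
  left; have [||w [Bw wC]] := fill_gap (s := s) al (pull B Bsmall).
  - by have [y yx] := lowB x Bx; exists y; rewrite /= yx.
  - move=> l Bl; apply: contrapT => lmax; apply: nomax.
    exists (e a lambda l) => // _ /[dup] /lowB[l' <-] Bl'; rewrite emb_dlt ?(ltW al) //.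
    have [ll'|->|] := @dlt_neg s _ _ l l'; [|by left|by right].
    by apply: lmax; exists l'.
  exists w; first by move=> _ /[dup] /lowB[l <-]; exact: Bw.
  move=> _ /[dup] /lowC[r <-] Cr; apply: wC => l Bl.
  by rewrite -(emb_dlt s _ _ (ltW al) (lexx _)); exact: BC.
have [[w Lw wR]|Lmax] := gap true L R Lsmall lowL lowR LR.
  by exists w; split=> x y; [move=> Lx ->; exact: Lw|move=> ->; exact: wR].
have [|[w Rw wL]|Rmin] := gap false R L Rsmall lowR lowL.
- by move=> x y Rx Ly; exact: LR.
- by exists w; split=> x y; [move=> Lx ->; exact: wL|move=> ->; exact: Rw].
have [[x0 _] unb dense] := stage_dense A_dense (lexx lambda).
have below m w : (forall x, L x -> x = m \/ x < m) -> m < w -> set_lt L [set w].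
  by move=> mmax mw x _ /mmax xm ->; case: xm => [->//|/lt_trans]; apply.
have above m w : (forall x, R x -> x = m \/ m < x) -> w < m -> set_lt [set w] R.
  by move=> mmin wm _ x -> /mmin[->//|]; apply: lt_trans.
case: Lmax Rmin => [L0|[m Lm mmax]] [R0|[n Rn nmin]].
- by exists x0; rewrite L0 R0; split=> [x y []|x y _ []].
- have [w wn] := unb false n; exists w; rewrite L0; split; first by move=> x y [].
  exact: above nmin wn.
- have [w mw] := unb true m; exists w; rewrite R0; split; last by move=> x y _ [].
  exact: below mmax mw.
have [w /andP[mw wn]] := dense m n (LR _ _ Lm Rn).
by exists w; split; [exact: below mmax mw|exact: above nmin wn].
Qed.

End Hierarchy.

Theorem theorem5p13 (dO : Order.disp_t) (Ord : wellOrderType dO)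
    (zero lambda : Ord) (zeroP : ord_zero zero)
    (inaccessible : strongly_inaccessible (aleph lambda))
    (S : signature) (d : Order.disp_t) (A : loStructure S d)
    (eta0 : eta_set zero A)
    (Y : ultrapower_hierarchy A lambda)
    (tails : forall b : Ord, b < lambda -> tails_ultrafilter (ultra Y b)) :
  eta_set lambda (stage Y lambda).
Proof. exact: hierarchy_eta tails (eta_set_dense eta0) inaccessible. Qed.
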